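(* Let $\chi:\mathcal I_X\times\mathcal I_W\to\{0,1\}$ be the residual-threshold predicate, $\mathcal I_X=\{0,\dots,N_X-1\}$, $\mathcal I_W=\{0,\dots,N_W-1\}$, and let $S_\chi$, $U_{\Psi_W}$, $Q$, $Q_i$ and $|\Psi\rangle_W$ be as defined in the context. Let $|\Psi_X\rangle=\sum_{i=0}^{N_X-1}\alpha_i|i\rangle_X$ with $\alpha_i\in\mathbb C$ and $\sum_{i=0}^{N_X-1}|\alpha_i|^2=1$. For $i\in\mathcal I_X$ set $$\mathcal M_i=\{\,j\in\mathcal I_W:\chi(i,j)=1\,\},\qquad \theta_i=\arcsin\left(\sqrt{\frac{|\mathcal M_i|}{N_W}}\right).$$ Then for every $k\in\mathbb N_0$, $$Q^k\bigl(|\Psi_X\rangle\otimes|\Psi\rangle_W\otimes|0\rangle_Z\otimes|0\rangle_A\bigr)=\sum_{i=0}^{N_X-1}\alpha_i\,|i\rangle_X\otimes Q_i^k|\Psi\rangle_W\otimes|0\rangle_Z\otimes|0\rangle_A .$$ The total success probability after $k$ iterations is $$P(k)=\sum_{i=0}^{N_X-1}|\alpha_i|^2\sin^2\bigl((2k+1)\theta_i\bigr).$$ Consequently, the optimal iteration count (the one maximizing the success probability) is characterized by $$k^\ast=\arg\max_{k\in\mathbb N_0}\ \sum_{i=0}^{N_X-1}|\alpha_i|^2\sin^2\bigl((2k+1)\theta_i\bigr).$$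
   Context: Registers: $\mathcal H_X=(\mathbb C^2)^{\otimes n_X}$, $\mathcal H_W=(\mathbb C^2)^{\otimes n_W}$, $\mathcal H_Z=(\mathbb C^2)^{\otimes n_Z}$, $\mathcal H_A=(\mathbb C^2)^{\otimes n_A}$, with computational bases $\{|i\rangle_X\}_{i=0}^{N_X-1}$, $\{|j\rangle_W\}_{j=0}^{N_W-1}$, $\{|k\rangle_Z\}_{k=0}^{N_Z-1}$, where $N_X=2^{n_X}$, $N_W=2^{n_W}$, $N_Z=2^{n_Z}$, and $|0\rangle_A$ a clean ancilla state. The state $|i\rangle_X$ encodes a collocation point $x_i$, $|j\rangle_W$ encodes a parameter vector $w_j$ in a finite set $W_m$, and $|k\rangle_Z$ encodes a signed (two's complement) fixed-point number $z_k$; $Z=\{z_k\}$. The full space is $\mathcal H=\mathcal H_X\otimes\mathcal H_W\otimes\mathcal H_Z\otimes\mathcal H_A$. Predicate: $r$ is a residual map assigning to each pair $(x_i,w_j)$ a value $r(x_i,w_j)\in Z$, and $\varepsilon_{\mathrm{tol}}\in Z$, $\varepsilon_{\mathrm{tol}}>0$, is a tolerance. Define $\chi(i,j)=1$ if $|r(x_i,w_j)|<\varepsilon_{\mathrm{tol}}$ and $\chi(i,j)=0$ otherwise. It is assumed that for all $(i,j)$ there is an index $\kappa(i,j)$ with $z_{\kappa(i,j)}=|r(x_i,w_j)|-\varepsilon_{\mathrm{tol}}$. Phase oracle: $U_c$ is a unitary on $\mathcal H$ with $U_c|i\rangle_X|j\rangle_W|0\rangle_Z|0\rangle_A=|i\rangle_X|j\rangle_W|\kappa(i,j)\rangle_Z|\varphi(i,j)\rangle_A$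 for some unit ancilla states $|\varphi(i,j)\rangle_A$. Let $S_Z|k\rangle_Z=(-1)^{\mathbf 1[z_k<0]}|k\rangle_Z$, $U_{\mathrm{phase}}=I_X\otimes I_W\otimes S_Z\otimes I_A$, and $S_\chi=U_c^\dagger U_{\mathrm{phase}}U_c$. Thus $S_\chi\bigl(|i\rangle_X|j\rangle_W|0\rangle_Z|0\rangle_A\bigr)=(-1)^{\chi(i,j)}|i\rangle_X|j\rangle_W|0\rangle_Z|0\rangle_A$. Iterates: $|\Psi\rangle_W=\frac1{\sqrt{N_W}}\sum_{j=0}^{N_W-1}|j\rangle_W$; $U_{\Psi_W}=2|\Psi\rangle\langle\Psi|_W-I_W$; $Q=(I_X\otimes U_{\Psi_W}\otimes I_Z\otimes I_A)\,S_\chi$ on $\mathcal H$; for $i\in\mathcal I_X$, $S_\chi^{(i)}=\sum_{j=0}^{N_W-1}(-1)^{\chi(i,j)}|j\rangle\langle j|_W$ and $Q_i=U_{\Psi_W}S_\chi^{(i)}$ on $\mathcal H_W$. Success probability: $P(k)$ is the probability that measuring the $X$ and $W$ registers of the state $Q^k(|\Psi_X\rangle\otimes|\Psi\rangle_W\otimes|0\rangle_Z\otimes|0\rangle_A)$ in the computational basis yields a pair $(i,j)$ with $j\in\mathcal M_i$, i.e. $\chi(i,j)=1$. *)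

(* Defs.v *)
From mathcomp Require Import all_boot all_order all_algebra.
From mathcomp Require Import all_classical all_reals.
From mathcomp Require Import trigo.
From mathcomp Require Export complex mxtens spectral.

Set Implicit Arguments.
Unset Strict Implicit.
Unset Printing Implicit Defensive.

Import Order.TTheory GRing.Theory Num.Theory.
Local Open Scope ring_scope.
Local Open Scope complex_scope.

Definition idx0 (n : nat) : 'I_(2 ^ n) := Ordinal (expn_gt0 2 n).

Definition ket (R : realType) (N : nat) (i : 'I_N) : 'cV[R[i]]_N :=
  delta_mx i 0.

Definition adj (R : realType) (m n : nat) (A : 'M[R[i]]_(m, n)) :
  'M[R[i]]_(n, m) := (A ^t*)%sesqui.

Definition norm2 (R : realType) (N : nat) (v : 'cV[R[i]]_N) : R :=
  \sum_i Normc.normc (v i 0) ^+ 2.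

Definition ketbra (R : realType) (N : nat) (v : 'cV[R[i]]_N) : 'M[R[i]]_N :=
  v *m adj v.

(* The registers X, W, Z, A are tensored in this order, bracketed to the
   right. *)
Definition dim4 (nX nW nZ nA : nat) : nat :=
  (2 ^ nX * (2 ^ nW * (2 ^ nZ * 2 ^ nA)))%N.

Definition tens4 (R : realType) (nX nW nZ nA : nat)
    (u : 'cV[R[i]]_(2 ^ nX)) (v : 'cV[R[i]]_(2 ^ nW))
    (a : 'cV[R[i]]_(2 ^ nZ)) (b : 'cV[R[i]]_(2 ^ nA)) :
  'cV[R[i]]_(dim4 nX nW nZ nA) := u *t (v *t (a *t b)).

Definition optens4 (R : realType) (nX nW nZ nA : nat)
    (A : 'M[R[i]]_(2 ^ nX)) (B : 'M[R[i]]_(2 ^ nW))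
    (C : 'M[R[i]]_(2 ^ nZ)) (D : 'M[R[i]]_(2 ^ nA)) :
  'M[R[i]]_(dim4 nX nW nZ nA) := A *t (B *t (C *t D)).

Definition twos_complement (n : nat) (k : 'I_(2 ^ n)) : int :=
  if (k < 2 ^ n.-1)%N then k%:Z else k%:Z - (2 ^ n)%N%:Z.

(* z_k, with f fractional bits; a negative f (scaling up) is allowed. *)
Definition fixed_point (R : realType) (f : int) (n : nat) (k : 'I_(2 ^ n)) :
  R := (twos_complement k)%:~R * 2 ^ (- f).

Definition chi (R : realType) (pT wT : Type) (nX nW : nat)
    (x : 'I_(2 ^ nX) -> pT) (w : 'I_(2 ^ nW) -> wT) (r : pT -> wT -> R)
    (eps : R) (i : 'I_(2 ^ nX)) (j : 'I_(2 ^ nW)) : bool :=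
  `|r (x i) (w j)| < eps.

Definition S_Z (R : realType) (f : int) (nZ : nat) : 'M[R[i]]_(2 ^ nZ) :=
  \sum_k (-1) ^+ (fixed_point R f k < 0)%R *: ketbra (ket R k).

Definition U_phase (R : realType) (f : int) (nX nW nZ nA : nat) :
  'M[R[i]]_(dim4 nX nW nZ nA) :=
  optens4 1%:M 1%:M (S_Z R f nZ) 1%:M.

Definition S_chi (R : realType) (f : int) (nX nW nZ nA : nat)
    (Uc : 'M[R[i]]_(dim4 nX nW nZ nA)) : 'M[R[i]]_(dim4 nX nW nZ nA) :=
  adj Uc *m U_phase R f nX nW nZ nA *m Uc.

Definition Psi_W (R : realType) (nW : nat) : 'cV[R[i]]_(2 ^ nW) :=
  ((Num.sqrt (2 ^ nW)%:R)^-1)%:C *: \sum_j ket R j.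

Definition U_PsiW (R : realType) (nW : nat) : 'M[R[i]]_(2 ^ nW) :=
  2 *: ketbra (Psi_W R nW) - 1%:M.

Definition Q (R : realType) (f : int) (nX nW nZ nA : nat)
    (Uc : 'M[R[i]]_(dim4 nX nW nZ nA)) : 'M[R[i]]_(dim4 nX nW nZ nA) :=
  optens4 1%:M (U_PsiW R nW) 1%:M 1%:M *m S_chi f Uc.

Definition S_chi_i (R : realType) (nX nW : nat)
    (c : 'I_(2 ^ nX) -> 'I_(2 ^ nW) -> bool) (i : 'I_(2 ^ nX)) :
  'M[R[i]]_(2 ^ nW) := \sum_j (-1) ^+ c i j *: ketbra (ket R j).

Definition Q_i (R : realType) (nX nW : nat)
    (c : 'I_(2 ^ nX) -> 'I_(2 ^ nW) -> bool) (i : 'I_(2 ^ nX)) :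
  'M[R[i]]_(2 ^ nW) := U_PsiW R nW *m S_chi_i R c i.

Definition marked (nX nW : nat) (c : 'I_(2 ^ nX) -> 'I_(2 ^ nW) -> bool)
    (i : 'I_(2 ^ nX)) : {set 'I_(2 ^ nW)} := [set j | c i j]%SET.

Definition theta (R : realType) (nX nW : nat)
    (c : 'I_(2 ^ nX) -> 'I_(2 ^ nW) -> bool) (i : 'I_(2 ^ nX)) : R :=
  asin (Num.sqrt (#|marked c i|%:R / (2 ^ nW)%:R)).

Definition Psi_X (R : realType) (nX : nat) (alpha : 'I_(2 ^ nX) -> R[i]) :
  'cV[R[i]]_(2 ^ nX) := \sum_i alpha i *: ket R i.

Definition init_state (R : realType) (nX nW nZ nA : nat)
    (alpha : 'I_(2 ^ nX) -> R[i]) : 'cV[R[i]]_(dim4 nX nW nZ nA) :=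
  tens4 (Psi_X alpha) (Psi_W R nW) (ket R (idx0 nZ)) (ket R (idx0 nA)).

(* Q ^+ k is the matrix power: square matrices of any size form a ring. *)
Definition state (R : realType) (f : int) (nX nW nZ nA : nat)
    (Uc : 'M[R[i]]_(dim4 nX nW nZ nA)) (alpha : 'I_(2 ^ nX) -> R[i])
    (k : nat) : 'cV[R[i]]_(dim4 nX nW nZ nA) :=
  Q f Uc ^+ k *m init_state nW nZ nA alpha.

(* Born rule for measuring X and W in the computational basis. *)
Definition measXW (R : realType) (nX nW nZ nA : nat)
    (v : 'cV[R[i]]_(dim4 nX nW nZ nA)) (i : 'I_(2 ^ nX)) (j : 'I_(2 ^ nW)) :
  R := norm2 (optens4 (ketbra (ket R i)) (ketbra (ket R j)) 1%:M 1%:M *m v).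

Definition success_prob (R : realType) (f : int) (nX nW nZ nA : nat)
    (c : 'I_(2 ^ nX) -> 'I_(2 ^ nW) -> bool)
    (Uc : 'M[R[i]]_(dim4 nX nW nZ nA)) (alpha : 'I_(2 ^ nX) -> R[i])
    (k : nat) : R :=
  \sum_i \sum_(j in marked c i) measXW (state f Uc alpha k) i j.

(* The set of all maximizers; it is empty when the supremum is not attained. *)
Definition argmax (R : realType) (F : nat -> R) : set nat :=
  [set k | forall l, F l <= F k]%classic.

(* Main.v *)
(** On [e_ij = |i>|j>|0>|0>], [S_chi] acts as the sign [(-1)^chi(i,j)], because
    [U_c] turns [e_ij] into an eigenvector of the phase flip and is then undone.
    Hence the span of the [e_ij] with [i] fixed is invariant under [Q], which
    acts there as [Q_i], and the full state is the superposition of independent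
    Grover searches.  Each search stays in the plane of vectors with one
    amplitude [a] on the marked and one amplitude [b] on the unmarked indices;
    there [Q_i] is the rotation by [2 theta_i]. *)

Require Import Defs.
From mathcomp Require Import all_boot all_order all_algebra.
From mathcomp Require Import all_classical all_reals.
From mathcomp Require Import trigo.
From mathcomp Require Import complex mxtens spectral.
From mathcomp Require Import ring.

Set Implicit Arguments.
Unset Strict Implicit.
Unset Printing Implicit Defensive.

Import Order.TTheory GRing.Theory Num.Theory.
Local Open Scope ring_scope.

(** * Bilinearity and mixed products of tensors *)

Lemma tensmx_suml (R : comPzRingType) (I : finType) (m n p q : nat)
    (A : I -> 'M[R]_(m, n)) (B : 'M[R]_(p, q)) :
  (\sum_i A i) *t B = \sum_i A i *t B.
Proof.
apply/matrixP=> a b; rewrite !mxE !summxE mulr_suml.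
by apply: eq_bigr => i _; rewrite !mxE.
Qed.

Lemma tensmx_sumr (R : comPzRingType) (I : finType) (m n p q : nat)
    (A : 'M[R]_(m, n)) (B : I -> 'M[R]_(p, q)) :
  A *t (\sum_i B i) = \sum_i A *t B i.
Proof.
apply/matrixP=> a b; rewrite !mxE !summxE mulr_sumr.
by apply: eq_bigr => i _; rewrite !mxE.
Qed.

Lemma tensmxZl (R : comPzRingType) (m n p q : nat) (a : R)
    (A : 'M[R]_(m, n)) (B : 'M[R]_(p, q)) : (a *: A) *t B = a *: (A *t B).
Proof. by apply/matrixP=> i j; rewrite !mxE mulrA. Qed.

Lemma tensmxZr (R : comPzRingType) (m n p q : nat) (a : R)
    (A : 'M[R]_(m, n)) (B : 'M[R]_(p, q)) : A *t (a *: B) = a *: (A *t B).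
Proof. by apply/matrixP=> i j; rewrite !mxE mulrCA. Qed.

Lemma mul_optens4 (R : realType) (nX nW nZ nA : nat)
    (A : 'M[R[i]]_(2 ^ nX)) (B : 'M[R[i]]_(2 ^ nW))
    (C : 'M[R[i]]_(2 ^ nZ)) (D : 'M[R[i]]_(2 ^ nA))
    (a : 'cV[R[i]]_(2 ^ nX)) (b : 'cV[R[i]]_(2 ^ nW))
    (c : 'cV[R[i]]_(2 ^ nZ)) (d : 'cV[R[i]]_(2 ^ nA)) :
  optens4 A B C D *m tens4 a b c d
  = tens4 (A *m a) (B *m b) (C *m c) (D *m d).
Proof.
rewrite /tens4 -(tensmx_mul C D c d) -(tensmx_mul B _ b).
by rewrite -(tensmx_mul A _ a).
Qed.

(** * Norms, kets and diagonal operators *)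

Lemma norm2_tens (R : realType) (m n : nat)
    (u : 'cV[R[i]]_m) (v : 'cV[R[i]]_n) :
  norm2 (u *t v : 'cV_(m * n)) = norm2 u * norm2 v.
Proof.
rewrite /norm2 mulr_sum; apply: eq_bigr => k _.
rewrite mxE Normc.normcM exprMn.
(* Both components of the column index of [u *t v] lie in ['I_1], hence are 0. *)
by congr (Normc.normc (u _ _) ^+ 2 * Normc.normc (v _ _) ^+ 2); rewrite ord1.
Qed.

Lemma norm2Z (R : realType) (n : nat) (a : R[i]) (v : 'cV[R[i]]_n) :
  norm2 (a *: v) = Normc.normc a ^+ 2 * norm2 v.
Proof.
rewrite /norm2 mulr_sumr; apply: eq_bigr => k _.
by rewrite mxE Normc.normcM exprMn.
Qed.

Lemma norm2_ket (R : realType) (n : nat) (i : 'I_n) : norm2 (ket R i) = 1.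
Proof.
rewrite /norm2 (bigD1 i) //= big1 => [|j ji].
  by rewrite mxE !eqxx Normc.normc1 expr1n addr0.
by rewrite mxE (negPf ji) Normc.normc0 expr0n.
Qed.

Lemma normc_real (R : realType) (a : R) : Normc.normc (a%:C)%C ^+ 2 = a ^+ 2.
Proof. by rewrite /= expr0n addr0 sqr_sqrtr ?sqr_ge0. Qed.

Lemma ketbra_mul (R : realType) (n : nat) (u v : 'cV[R[i]]_n) :
  ketbra u *m v = (adj u *m v) 0 0 *: u.
Proof.
rewrite /ketbra -mulmxA [adj u *m v]mx11_scalar mul_mx_scalar.
by rewrite [in RHS]mxE eqxx mulr1n.
Qed.

Lemma ketbra_ket_mul (R : realType) (n : nat) (j : 'I_n) (v : 'cV[R[i]]_n) :
  ketbra (ket R j) *m v = v j 0 *: ket R j.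
Proof.
rewrite ketbra_mul; congr (_ *: _).
rewrite mxE (bigD1 j) //= big1 => [|k kj]; rewrite !mxE.
  by rewrite !eqxx rmorph_nat mul1r addr0.
by rewrite (negPf kj) rmorph_nat mul0r.
Qed.

Lemma ket_decomp (R : realType) (n : nat) (v : 'cV[R[i]]_n) :
  v = \sum_j v j 0 *: ket R j.
Proof.
by rewrite {1}[v]matrix_sum_delta; apply: eq_bigr => j _; rewrite big_ord1.
Qed.

Lemma diag_ketbra_mul (R : realType) (n : nat) (a : 'I_n -> R[i])
    (v : 'cV[R[i]]_n) :
  (\sum_j a j *: ketbra (ket R j)) *m v = \sum_j (a j * v j 0) *: ket R j.
Proof.
rewrite mulmx_suml; apply: eq_bigr => j _.
by rewrite -scalemxAl ketbra_ket_mul scalerA.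
Qed.

Lemma diag_ketbra_ket (R : realType) (n : nat) (a : 'I_n -> R[i]) (k : 'I_n) :
  (\sum_j a j *: ketbra (ket R j)) *m ket R k = a k *: ket R k.
Proof.
rewrite diag_ketbra_mul (bigD1 k) //= big1 => [|j jk]; rewrite mxE.
  by rewrite !eqxx mulr1 addr0.
by rewrite (negPf jk) mulr0 scale0r.
Qed.

(** * The oracle and the iterate on slices with fixed [i] *)

Lemma S_chi_ket (R : realType) (f : int) (nX nW nZ nA : nat)
    (Uc : 'M[R[i]]_(dim4 nX nW nZ nA)) (Uc_unitary : Uc \is unitarymx)
    (u : 'cV[R[i]]_(dim4 nX nW nZ nA))
    (i : 'I_(2 ^ nX)) (j : 'I_(2 ^ nW)) (k : 'I_(2 ^ nZ))
    (p : 'cV[R[i]]_(2 ^ nA))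
    (UcE : Uc *m u = tens4 (ket R i) (ket R j) (ket R k) p) :
  S_chi f Uc *m u = (-1) ^+ (fixed_point R f k < 0)%R *: u.
Proof.
rewrite /S_chi -!mulmxA UcE /U_phase mul_optens4 !mul1mx diag_ketbra_ket.
rewrite /tens4 tensmxZl !tensmxZr -[_ *t _]/(tens4 _ _ _ _) -UcE.
rewrite -scalemxAr mulmxA; congr (_ *: _).
(* Unitarity is given as [Uc *m adj Uc = 1]; for square matrices the two factors may be swapped. *)
by rewrite /adj; have /unitarymxP/mulmx1C -> := Uc_unitary; rewrite mul1mx.
Qed.

(** Both sides are linear in [v], so the sign rule [ScE] on basis states suffices. An arbitrary [v]
    is allowed because iteration leads away from the kets. *)
Lemma S_chi_slice (R : realType) (f : int) (nX nW nZ nA : nat)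
    (Uc : 'M[R[i]]_(dim4 nX nW nZ nA))
    (c : 'I_(2 ^ nX) -> 'I_(2 ^ nW) -> bool)
    (z : 'cV[R[i]]_(2 ^ nZ)) (a : 'cV[R[i]]_(2 ^ nA))
    (ScE : forall i j, S_chi f Uc *m tens4 (ket R i) (ket R j) z a
       = (-1) ^+ c i j *: tens4 (ket R i) (ket R j) z a)
    (i : 'I_(2 ^ nX)) (v : 'cV[R[i]]_(2 ^ nW)) :
  S_chi f Uc *m tens4 (ket R i) v z a = tens4 (ket R i) (S_chi_i R c i *m v) z a.
Proof.
rewrite {1}[v]ket_decomp diag_ketbra_mul /tens4 !tensmx_suml !tensmx_sumr.
rewrite mulmx_sumr; apply: eq_bigr => j _.
rewrite !tensmxZl !tensmxZr -scalemxAr -[_ *t _]/(tens4 _ _ _ _) ScE scalerA.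
by rewrite mulrC.
Qed.

Lemma Q_slice_pow (R : realType) (f : int) (nX nW nZ nA : nat)
    (Uc : 'M[R[i]]_(dim4 nX nW nZ nA))
    (c : 'I_(2 ^ nX) -> 'I_(2 ^ nW) -> bool)
    (z : 'cV[R[i]]_(2 ^ nZ)) (a : 'cV[R[i]]_(2 ^ nA))
    (ScE : forall i j, S_chi f Uc *m tens4 (ket R i) (ket R j) z a
       = (-1) ^+ c i j *: tens4 (ket R i) (ket R j) z a)
    (i : 'I_(2 ^ nX)) (v : 'cV[R[i]]_(2 ^ nW)) (k : nat) :
  Q f Uc ^+ k *m tens4 (ket R i) v z a = tens4 (ket R i) (Q_i R c i ^+ k *m v) z a.
Proof.
elim: k => [|k IHk]; first by rewrite !expr0 !mul1mx.
rewrite !exprS -[_ * _]/(_ *m _) -mulmxA IHk /Q -mulmxA (S_chi_slice ScE).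
by rewrite mul_optens4 !mul1mx !mulmxA.
Qed.

Lemma Q_pow_init (R : realType) (f : int) (nX nW nZ nA : nat)
    (Uc : 'M[R[i]]_(dim4 nX nW nZ nA))
    (c : 'I_(2 ^ nX) -> 'I_(2 ^ nW) -> bool)
    (z : 'cV[R[i]]_(2 ^ nZ)) (a : 'cV[R[i]]_(2 ^ nA))
    (ScE : forall i j, S_chi f Uc *m tens4 (ket R i) (ket R j) z a
       = (-1) ^+ c i j *: tens4 (ket R i) (ket R j) z a)
    (alpha : 'I_(2 ^ nX) -> R[i]) (v : 'cV[R[i]]_(2 ^ nW)) (k : nat) :
  Q f Uc ^+ k *m tens4 (Psi_X alpha) v z a
  = \sum_i alpha i *: tens4 (ket R i) (Q_i R c i ^+ k *m v) z a.
Proof.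
rewrite /Psi_X {1}/tens4 tensmx_suml mulmx_sumr; apply: eq_bigr => i _.
by rewrite tensmxZl -scalemxAr -[_ *t _]/(tens4 _ _ _ _) (Q_slice_pow ScE).
Qed.

(** The projector on [ket R i] kills every slice [l != i], so different slices do not interfere; the
    kets of Z and A contribute norm 1. *)
Lemma measXW_slices (R : realType) (nX nW nZ nA : nat)
    (alpha : 'I_(2 ^ nX) -> R[i]) (v : 'I_(2 ^ nX) -> 'cV[R[i]]_(2 ^ nW))
    (z : 'I_(2 ^ nZ)) (a : 'I_(2 ^ nA)) (i : 'I_(2 ^ nX)) (j : 'I_(2 ^ nW)) :
  measXW (\sum_l alpha l *: tens4 (ket R l) (v l) (ket R z) (ket R a)) i j
  = Normc.normc (alpha i) ^+ 2 * Normc.normc (v i j 0) ^+ 2.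
Proof.
rewrite /measXW mulmx_sumr (bigD1 i) //= big1 => [|l li].
  rewrite addr0 -scalemxAr mul_optens4 !mul1mx !ketbra_ket_mul mxE !eqxx scale1r.
  rewrite norm2Z /tens4 !norm2_tens norm2Z !norm2_ket; ring.
rewrite -scalemxAr mul_optens4 ketbra_ket_mul mxE eq_sym (negPf li).
by rewrite scale0r /tens4 tens0mx scaler0.
Qed.

(** * The Grover rotation on the W register *)

Lemma Psi_WE (R : realType) (n : nat) (j : 'I_(2 ^ n)) :
  Psi_W R n j 0 = ((Num.sqrt (2 ^ n)%:R)^-1%:C)%C.
Proof.
rewrite /Psi_W mxE summxE (bigD1 j) //= big1 => [|l lj]; rewrite mxE.
  by rewrite !eqxx addr0 mulr1.
by rewrite eq_sym (negPf lj).
Qed.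

(** Inversion about the mean: the overlap with [Psi_W] and the entry of [Psi_W] each supply one
    inverse square root of [2 ^ n]. *)
Lemma U_PsiWE (R : realType) (n : nat) (v : 'cV[R[i]]_(2 ^ n)) (j : 'I_(2 ^ n)) :
  (U_PsiW R n *m v) j 0 = 2 * (((2 ^ n)%:R^-1 : R)%:C)%C * (\sum_l v l 0) - v j 0.
Proof.
rewrite /U_PsiW mulmxBl mul1mx -scalemxAl ketbra_mul.
have := @Psi_WE R n; move: (Psi_W R n) => p pE; rewrite !mxE pE.
congr (_ - _); rewrite -mulrA; congr (_ * _).
rewrite mulrC [in RHS]mulr_sumr mulr_sumr; apply: eq_bigr => l _.
rewrite /adj !mxE pE [_^*]conjc_real mulrA -rmorphM /=.
by rewrite -invfM -expr2 sqr_sqrtr ?ler0n.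
Qed.

Lemma S_chi_iE (R : realType) (nX nW : nat)
    (c : 'I_(2 ^ nX) -> 'I_(2 ^ nW) -> bool) (i : 'I_(2 ^ nX))
    (v : 'cV[R[i]]_(2 ^ nW)) (j : 'I_(2 ^ nW)) :
  (S_chi_i R c i *m v) j 0 = (-1) ^+ c i j * v j 0.
Proof.
rewrite diag_ketbra_mul summxE (bigD1 j) //= big1 => [|l lj]; rewrite !mxE.
  by rewrite !eqxx mulr1 addr0.
by rewrite eq_sym (negPf lj) mulr0.
Qed.

Lemma sin_theta_sqr (R : realType) (nX nW : nat)
    (c : 'I_(2 ^ nX) -> 'I_(2 ^ nW) -> bool) (i : 'I_(2 ^ nX)) :
  sin (theta R c i) ^+ 2 = #|marked c i|%:R / (2 ^ nW)%:R.
Proof.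
have N_gt0 : 0 < (2 ^ nW)%:R :> R by rewrite ltr0n expn_gt0.
have p_ge0 : 0 <= #|marked c i|%:R / (2 ^ nW)%:R :> R.
  by rewrite divr_ge0 ?ler0n.
(* [asinK] needs an argument in [-1, 1]; the upper bound holds because at most [2 ^ nW] indices are
   marked. *)
rewrite asinK ?sqr_sqrtr // in_itv /= (le_trans _ (sqrtr_ge0 _)) ?lerN10 //=.
rewrite -[leRHS]sqrtr1 ler_wsqrtr // ler_pdivrMr // mul1r ler_nat.
by rewrite (leq_trans (max_card _)) ?card_ord.
Qed.

Lemma sum_marked (R : realType) (nX nW : nat)
    (c : 'I_(2 ^ nX) -> 'I_(2 ^ nW) -> bool) (i : 'I_(2 ^ nX)) (a b : R) :
  \sum_j (if c i j then a else b)
  = #|marked c i|%:R * a + ((2 ^ nW)%:R - #|marked c i|%:R) * b.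
Proof.
rewrite (bigID (mem (marked c i))) /=; congr (_ + _).
  rewrite (eq_bigr (fun=> a)) => [|j]; last by rewrite inE => ->.
  by rewrite sumr_const mulr_natl.
rewrite (eq_bigr (fun=> b)) => [|j]; last by rewrite inE => /negPf ->.
rewrite (eq_bigl (mem (~: marked c i)%SET)) => [|j]; last by rewrite !inE.
rewrite sumr_const -(mulr_natl b); congr (_ * _); apply/eqP.
by rewrite eq_sym subr_eq addrC -natrD cardsC card_ord.
Qed.

(* [a] and [b] appear multiplied by [sin theta] and [cos theta]: if all or none
   of the indices are marked, one of these factors vanishes and the
   corresponding amplitude is irrelevant. *)
Lemma Q_i_pow_Psi_W (R : realType) (nX nW : nat)
    (c : 'I_(2 ^ nX) -> 'I_(2 ^ nW) -> bool) (i : 'I_(2 ^ nX)) (k : nat) :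
  exists a b : R,
    [/\ forall j, (Q_i R c i ^+ k *m Psi_W R nW) j 0
                  = ((if c i j then a else b)%:C)%C,
        Num.sqrt (2 ^ nW)%:R * a * sin (theta R c i)
        = sin ((2 * k + 1)%:R * theta R c i)
      & Num.sqrt (2 ^ nW)%:R * b * cos (theta R c i)
        = cos ((2 * k + 1)%:R * theta R c i)].
Proof.
have N_neq0 : (2 ^ nW)%:R != 0 :> R by rewrite pnatr_eq0 expn_eq0.
have sN_neq0 : Num.sqrt (2 ^ nW)%:R != 0 :> R.
  by rewrite sqrtr_eq0 -ltNge ltr0n expn_gt0.
elim: k => [|k [a [b [vE aE bE]]]].
  exists (Num.sqrt (2 ^ nW)%:R)^-1, (Num.sqrt (2 ^ nW)%:R)^-1.
  split; rewrite ?muln0 ?add0n ?mul1r ?divff ?mul1r //.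
  by move=> j; rewrite expr0 mul1mx Psi_WE if_same.
set t := theta R c i in aE bE *.
have s2 := sin_theta_sqr R c i; rewrite -/t in s2.
(* [m] is twice the mean amplitude after the sign flip: [sin t ^+ 2] is the fraction of marked
   indices, [cos t ^+ 2] that of unmarked ones. *)
pose m := 2 * (cos t ^+ 2 * b - sin t ^+ 2 * a).
have tE : (2 * k.+1 + 1)%:R * t = (2 * k + 1)%:R * t + (t + t).
  rewrite !natrD !natrM -natr1; ring.
(* Inversion about the mean sends the flipped marked amplitude [- a] to [m + a] and [b] to
   [m - b]. *)
exists (m + a), (m - b); split.
- move=> j; rewrite exprS -[_ * _]/(_ *m _) -mulmxA /Q_i -mulmxA U_PsiWE.
  rewrite S_chi_iE vE.
  have signE l : (-1) ^+ c i l * ((if c i l then a else b)%:C)%C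
     = ((if c i l then - a else b)%:C)%C.
    by case: (c i l); rewrite ?mul1r // mulN1r rmorphN.
  rewrite (eq_bigr (fun l => ((if c i l then - a else b)%:C)%C)); last first.
    by move=> l _; rewrite S_chi_iE vE signE.
  rewrite signE -rmorph_sum sum_marked -(rmorph_nat (real_complex R) 2).
  rewrite -!rmorphM -rmorphB; congr (_%:C)%C.
  have -> : m = 2 * (2 ^ nW)%:R^-1
     * (#|marked c i|%:R * - a + ((2 ^ nW)%:R - #|marked c i|%:R) * b).
    by rewrite /m cos2sin2 s2; field.
  by case: (c i j); rewrite ?opprK.
(* Writing the coefficient 1 of [a] as [cos t ^+ 2 + sin t ^+ 2] turns the angle addition formula
   into a polynomial identity; the cosine case treats [b] likewise. *)
- rewrite tE sinD -aE -bE sinD cosD -[a in m + a]mul1r -(cos2Dsin2 t) /m; ring.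
- rewrite tE cosD -aE -bE sinD cosD -[b in m - b]mul1r -(cos2Dsin2 t) /m; ring.
Qed.

Theorem theorem4p4 (R : realType) (nX nW nZ nA : nat)
    (pT wT : Type) (x : 'I_(2 ^ nX) -> pT) (w : 'I_(2 ^ nW) -> wT)
    (Wm : set wT) (Wm_finite : finite_set Wm) (w_in_Wm : forall j, Wm (w j))
    (f : int) (r : pT -> wT -> R)
    (r_in_Z : forall i j, exists k : 'I_(2 ^ nZ),
        fixed_point R f k = r (x i) (w j))
    (eps : R) (eps_in_Z : exists k : 'I_(2 ^ nZ), fixed_point R f k = eps)
    (eps_gt0 : 0 < eps)
    (kappa : 'I_(2 ^ nX) -> 'I_(2 ^ nW) -> 'I_(2 ^ nZ))
    (kappaE : forall i j,
        fixed_point R f (kappa i j) = `|r (x i) (w j)| - eps)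
    (Uc : 'M[R[i]]_(dim4 nX nW nZ nA)) (Uc_unitary : Uc \is unitarymx)
    (phi : 'I_(2 ^ nX) -> 'I_(2 ^ nW) -> 'cV[R[i]]_(2 ^ nA))
    (phi_unit : forall i j, norm2 (phi i j) = 1)
    (UcE : forall i j,
        Uc *m tens4 (ket R i) (ket R j) (ket R (idx0 nZ)) (ket R (idx0 nA))
        = tens4 (ket R i) (ket R j) (ket R (kappa i j)) (phi i j))
    (alpha : 'I_(2 ^ nX) -> R[i])
    (alpha_unit : \sum_i Normc.normc (alpha i) ^+ 2 = 1) :
  let c := chi x w r eps in
  let P := success_prob f c Uc alpha in
  let F := fun k : nat =>
    \sum_i Normc.normc (alpha i) ^+ 2 * sin ((2 * k + 1)%:R * theta R c i) ^+ 2 in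
  [/\ forall k : nat,
        Q f Uc ^+ k *m tens4 (Psi_X alpha) (Psi_W R nW)
                             (ket R (idx0 nZ)) (ket R (idx0 nA))
        = \sum_i alpha i *: tens4 (ket R i) (Q_i R c i ^+ k *m Psi_W R nW)
                                  (ket R (idx0 nZ)) (ket R (idx0 nA)),
      forall k : nat, P k = F k
    & argmax P = argmax F].
Proof.
move=> c P F.
have ScE i j : S_chi f Uc *m tens4 (ket R i) (ket R j) (ket R (idx0 nZ))
      (ket R (idx0 nA))
    = (-1) ^+ c i j *: tens4 (ket R i) (ket R j) (ket R (idx0 nZ))
      (ket R (idx0 nA)).
  (* The sign bit of the number stored in Z is the predicate: [|r| - eps < 0] exactly when
     [|r| < eps]. *)
  by rewrite (S_chi_ket f Uc_unitary (UcE i j)) kappaE subr_lt0.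
have PE k : P k = F k.
  apply: eq_bigr => i _.
  rewrite /state /init_state (Q_pow_init ScE).
  under eq_bigr => j _ do rewrite measXW_slices.
  rewrite -mulr_sumr; congr (_ * _).
  (* Every marked entry equals [a], so the slice has success probability [#|marked c i| * a ^+ 2].
     This is the square of the rewritten sine; without division by [sin (theta R c i)], an empty
     marked set needs no separate case. *)
  have [a [b [vE <- _]]] := Q_i_pow_Psi_W R c i k.
  rewrite (eq_bigr (fun=> a ^+ 2)) => [|j]; last first.
    by rewrite inE vE => ->; rewrite normc_real.
  have N_neq0 : (2 ^ nW)%:R != 0 :> R by rewrite pnatr_eq0 expn_eq0.
  rewrite sumr_const !exprMn sin_theta_sqr sqr_sqrtr ?ler0n // -mulr_natl.
  by field.
split=> //; first exact: Q_pow_init.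
by congr argmax; apply/funext.
Qed.
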